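(* Let $\sigma=\sum_{j=1}^m q_j\delta_{y_j}$ with $y_1<\dots<y_m$, $q_j>0$, $\sum_{j=1}^m q_j=1$, and $\mu=\sum_{i=1}^n p_i\delta_{x_i}$ with $x_1<\dots<x_n$, $p_i>0$, $\sum_{i=1}^n p_i=1$, be probability measures on $\mathbb{R}$. Put $Q_j=\sum_{\ell=1}^j q_\ell$ and $P_i=\sum_{k=1}^i p_k$, and let $T_\mu=F_\mu^{-1}\circ F_\sigma$ be the discrete cumulative distribution transform of $\mu$ relative to $\sigma$. Then for every $j\in\{1,\dots,m\}$, $$T_\mu(y_j)=x_i,\qquad i=\min\{k:\ P_k\ge Q_j\}.$$
   Context: For a Borel probability measure $\mu$ on $\mathbb{R}$, $F_\mu(x)=\mu((-\infty,x])$ is its cumulative distribution function, and its generalized inverse is $F_\mu^{-1}(s)=\inf\{x\in\mathbb{R}: F_\mu(x)\ge s\}$ for $s\in(0,1]$. The discrete cumulative distribution transform (CDT) of $\mu$ relative to $\sigma$ is the map $T_\mu=F_\mu^{-1}\circ F_\sigma$, determined by its values on the support $\{y_1,\dots,y_m\}$ of $\sigma$. $\delta_x$ is the Dirac mass at $x$. *)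

(* Defs.v *)
From HB Require Import structures.
From mathcomp Require Import all_boot all_order all_algebra.
From mathcomp Require Import all_classical all_reals all_analysis.

Set Implicit Arguments.
Unset Strict Implicit.
Unset Printing Implicit Defensive.

Import Order.TTheory GRing.Theory Num.Theory.

Local Open Scope classical_set_scope.
Local Open Scope ring_scope.
Local Open Scope ereal_scope.

(* The library's [cdf] is attached to a random variable; here the law itself is
   given, and [cdf_of mu] is the [cdf] of the identity under [mu]. *)
Definition cdf_of (R : realType) (mu : probability (measurableTypeR R) R)
  (x : R) : \bar R := mu [set` `]-oo, x]].

(* The infimum is taken in the extended reals: for s = 1 it is +oo when [mu] has
   unbounded upper tail. The intended range of s is ]0, 1]. *)
Definition quantile (R : realType) (mu : probability (measurableTypeR R) R)
  (s : \bar R) : \bar R :=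
  ereal_inf [set x%:E | x in [set x : R | s <= cdf_of mu x]].

Definition cdt (R : realType) (sigma mu : probability (measurableTypeR R) R) :
  R -> \bar R := quantile mu \o cdf_of sigma.

(* Equality of Borel measures, mu = \sum_(i < n) p_i \d_(x_i). *)
Definition is_discrete (R : realType) (n : nat) (p x : 'I_n -> R)
  (mu : probability (measurableTypeR R) R) : Prop :=
  forall A : set (measurableTypeR R), measurable A ->
    mu A = \sum_(i < n) (p i)%:E * \d_(x i : measurableTypeR R) A.

(* P_i = p_1 + ... + p_i, with the term of index i included. *)
Definition partial_sum (R : realType) (n : nat) (p : 'I_n -> R) (i : 'I_n) : R :=
  (\sum_(k < n | (k <= i)%N) p k)%R.

(* Main.v *)
Require Import Defs.
From mathcomp Require Import all_boot all_order all_algebra.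
From mathcomp Require Import all_classical all_reals all_analysis.

Import Order.TTheory GRing.Theory Num.Theory.
Local Open Scope ring_scope.

(** Since the atoms increase, the cdf of a discrete law at its atom of index j is the j-th partial
    sum of the weights ([cdf_of_discrete_atom]); thus F_sigma(y_j) = Q_j. The cdf of [mu] is a step
    function that rises only at the atoms x_k, where it reaches P_k. Hence for s > 0 the set of a
    with F_mu(a) >= s is the half-line starting at the first atom with P_k >= s, and its infimum is
    that atom ([quantile_discrete]). Taking s = Q_j gives the formula. *)

Section Discrete.
Set Implicit Arguments.
Unset Strict Implicit.

Variables (R : realType) (n : nat) (p x : 'I_n -> R).
Variable mu : probability (measurableTypeR R) R.
Hypothesis p_gt0 : forall i, 0 < p i.
Hypothesis x_incr : forall i k : 'I_n, (i < k)%N -> x i < x k.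
Hypothesis muE : is_discrete p x mu.

Lemma cdf_of_discrete (a : R) :
  cdf_of mu a = (\sum_(i < n | x i <= a) p i)%:E.
Proof.
rewrite /cdf_of muE; last exact: measurable_itv.
rewrite -sumEFin [RHS]big_mkcond; apply: eq_bigr => i _.
rewrite diracE mem_setE in_itv /=.
by case: (x i <= a); rewrite ?mule1 ?mule0.
Qed.

Lemma ler_increasing (i k : 'I_n) : (x i <= x k) = (i <= k)%N.
Proof.
case: (ltngtP i k) => [/x_incr/ltW -> //|/x_incr|/val_inj ->]; last exact: lexx.
by rewrite ltNge => /negbTE.
Qed.

Lemma cdf_of_discrete_atom (i : 'I_n) : cdf_of mu (x i) = (partial_sum p i)%:E.
Proof.
rewrite cdf_of_discrete /partial_sum; congr EFin.
by apply: eq_bigl => k; rewrite ler_increasing.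
Qed.

Lemma partial_sum_gt0 (i : 'I_n) : 0 < partial_sum p i.
Proof.
rewrite /partial_sum (bigD1 i) //= ltr_pwDl // sumr_ge0 // => k _.
exact: ltW.
Qed.

Lemma partial_sum_le_total (i : 'I_n) : partial_sum p i <= \sum_(k < n) p k.
Proof.
rewrite /partial_sum big_mkcond ler_sum // => k _.
by case: ifP => // _; exact: ltW.
Qed.

(** The point x_i belongs to the set whose infimum is taken. Conversely, if the cdf at a reaches s,
    then so does P_k for the last atom x_k <= a, and minimality of i gives x_i <= x_k <= a. *)
Lemma quantile_discrete (s : R) (i : 'I_n) :
    0 < s -> s <= partial_sum p i ->
    (forall k : 'I_n, s <= partial_sum p k -> (i <= k)%N) ->
  quantile mu s%:E = (x i)%:E.
Proof.
move=> s_gt0 s_le i_min; apply/le_anti/andP; split.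
  apply: ereal_inf_lbound; exists (x i) => //=.
  by rewrite cdf_of_discrete_atom lee_fin.
apply: le_ereal_inf_tmp => _ [a /= s_le_a <-]; rewrite lee_fin.
move: s_le_a; rewrite cdf_of_discrete lee_fin => s_le_a.
(* Positivity of s enters here: with no atom in ]-oo, a] the cdf at a would be 0 < s. *)
have [k0 k0_le|no_atom] := pickP (fun k => x k <= a); last first.
  by move: s_le_a; rewrite big_pred0 // leNgt s_gt0.
(* With k the last atom in ]-oo, a], the cdf at a is at most P_k. *)
case: (@arg_maxnP _ k0 (fun k => x k <= a) val k0_le) => k k_le k_max.
apply: le_trans k_le; rewrite ler_increasing; apply: i_min.
apply: le_trans s_le_a _.
rewrite /partial_sum big_mkcond [leRHS]big_mkcond ler_sum // => l _.
case: ifP => [/k_max /= -> //|_]; case: ifP => // _; exact: ltW.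
Qed.

End Discrete.

Theorem proposition3p3 (R : realType) (m n : nat)
  (q y : 'I_m -> R) (p x : 'I_n -> R)
  (sigma mu : probability (measurableTypeR R) R)
  (y_incr : forall j k : 'I_m, (j < k)%N -> y j < y k)
  (q_gt0 : forall j : 'I_m, 0 < q j)
  (q_sum1 : \sum_(j < m) q j = 1)
  (sigmaE : is_discrete q y sigma)
  (x_incr : forall i k : 'I_n, (i < k)%N -> x i < x k)
  (p_gt0 : forall i : 'I_n, 0 < p i)
  (p_sum1 : \sum_(i < n) p i = 1)
  (muE : is_discrete p x mu) :
  forall j : 'I_m, exists i : 'I_n,
    [/\ partial_sum q j <= partial_sum p i,
        forall k : 'I_n, partial_sum q j <= partial_sum p k -> (i <= k)%N
      & cdt sigma mu (y j) = (x i)%:E].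
Proof.
move=> j.
(* The last index is admissible, as its partial sum is the total mass 1 >= Q_j; so the minimum
   ranges over a nonempty set. *)
have Pmax (k : 'I_n) : k = n.-1 :> nat -> partial_sum q j <= partial_sum p k.
  move=> kE; have -> : partial_sum p k = 1.
    rewrite -p_sum1; apply: eq_bigl => l.
    by rewrite kE -ltnS (ltn_predK (ltn_ord k)) ltn_ord.
  by rewrite -q_sum1; exact: partial_sum_le_total.
(* A last index exists: for n = 0 the weights would sum to 0, not 1. *)
have n_gt0 : (n.-1 < n)%N.
  rewrite ltn_predL lt0n; apply/eqP => n0; subst n.
  by move/eqP: p_sum1; rewrite big_ord0 eq_sym oner_eq0.
pose good (k : 'I_n) := partial_sum q j <= partial_sum p k.
case: (@arg_minnP _ (Ordinal n_gt0) good val (Pmax (Ordinal n_gt0) erefl)) => i Pi i_min.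
exists i; split => //.
rewrite /cdt /= (cdf_of_discrete_atom y_incr sigmaE).
by apply: quantile_discrete => //; exact: partial_sum_gt0.
Qed.
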